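(* Let $\omega\subset\mathbb{R}^2$ be a bounded Lipschitz domain and let $\gamma_d$ be a relatively open, non-empty subset of the boundary $\partial\omega$. Assume that $m,y_0\in C^2(\overline{\omega},\mathbb{R}^3)$ are two regular surfaces with $$[\mathrm{D}m(x)]^T\mathrm{D}m(x)=[\mathrm{D}y_0(x)]^T\mathrm{D}y_0(x),\qquad n(x)=n_0(x)\qquad\text{for all }x\in\overline{\omega},$$ $$m|_{\gamma_d}=y_0|_{\gamma_d},$$ where $n=\dfrac{\partial_1m\times\partial_2m}{\|\partial_1m\times\partial_2m\|}$ and $n_0=\dfrac{\partial_1y_0\times\partial_2y_0}{\|\partial_1y_0\times\partial_2y_0\|}$ are the respective normal fields. Then $m\equiv y_0$.
   Context: A domain is an open connected set. For a map $m$ from (the closure of) $\omega\subset\mathbb{R}^2$ to $\mathbb{R}^3$, $\mathrm{D}m=(\partial_1m\,|\,\partial_2m)$ is the $3\times2$ Jacobi matrix. Such a $C^1$ map is called a regular surface if its Jacobi matrix has rank $2$ everywhere on its domain of definition (no injectivity is required). $C^k(\overline{\omega},\cdot)$ denotes maps that are $C^k$ up to the boundary, i.e. all partial derivatives up to order $k$ extend continuously to $\overline{\omega}$. *)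

(* Defs.v *)
From mathcomp Require Import all_boot all_order all_algebra.
From mathcomp Require Import all_classical all_reals all_analysis.

Set Implicit Arguments.
Unset Strict Implicit.
Unset Printing Implicit Defensive.

Import Order.TTheory GRing.Theory Num.Theory.
Import numFieldNormedType.Exports.

Local Open Scope classical_set_scope.
Local Open Scope ring_scope.

Section domains.
Context {R : realType}.
Implicit Types (w g : set 'cV[R]_2).

Definition boundary w : set 'cV[R]_2 := closure w `\` w°.

(* Near each boundary point [w] is, in suitable orthonormal coordinates
   [Q *m x], the strict epigraph of a Lipschitz function. *)
Definition lipschitz_boundary w :=
  forall p, boundary w p ->
    exists (Q : 'M[R]_2) (phi : R -> R),
      [/\ Q^T *m Q = 1%:M,
          [lipschitz phi t | t in setT] &
          \forall x \near p,
            w x <-> phi ((Q *m x) ord0 ord0) < (Q *m x) ord_max ord0].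

Definition bounded_lipschitz_domain w :=
  [/\ open w, connected w, bounded_set w & lipschitz_boundary w].

Definition relatively_open_in_boundary w g :=
  exists2 U : set 'cV[R]_2, open U & g = U `&` boundary w.

End domains.

Section smoothness.
Context {R : realType} {n : nat}.
Implicit Types (w : set 'cV[R]_2) (f : 'cV[R]_2 -> 'cV[R]_n.+1).

Definition partial (i : 'I_2) f : 'cV[R]_2 -> 'cV[R]_n.+1 :=
  fun x => 'D_(delta_mx i ord0) f x.

Definition partials (s : seq 'I_2) f := foldr partial f s.

Definition extends_continuously w f :=
  exists2 F : 'cV[R]_2 -> 'cV[R]_n.+1,
    {within closure w, continuous F} & forall x, w x -> F x = f x.

(* A map on the closure of [w] is a total function whose values outside that
   closure are irrelevant; derivatives are taken at points of the open set [w]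
   only. *)
Definition Ck_closure (k : nat) w f :=
  [/\ {within closure w, continuous f},
      forall (s : seq 'I_2) (i : 'I_2) x, (size s < k)%N -> w x ->
        derivable (partials s f) x (delta_mx i ord0) &
      forall s : seq 'I_2, (size s <= k)%N ->
        extends_continuously w (partials s f)].

(* The value at [x] in the closure of [w] of the continuous extension of the
   [i]-th partial derivative. *)
Definition cpartial w (i : 'I_2) f (x : 'cV[R]_2) : 'cV[R]_n.+1 :=
  lim (partial i f z @[z --> within w (nbhs x)]).

End smoothness.

Section surfaces.
Context {R : realType}.
Implicit Types (w : set 'cV[R]_2) (f : 'cV[R]_2 -> 'cV[R]_3) (u v : 'cV[R]_3).

Definition jacobi w f (x : 'cV[R]_2) : 'M[R]_(3, 2) :=
  \matrix_(i < 3, j < 2) cpartial w j f x i ord0.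

Definition regular_surface w f :=
  forall x, closure w x -> \rank (jacobi w f x) = 2%N.

Definition cross u v : 'cV[R]_3 :=
  let a k := u (inord k) ord0 in
  let b k := v (inord k) ord0 in
  \col_(i < 3) [:: a 1%N * b 2%N - a 2%N * b 1%N;
                   a 2%N * b 0%N - a 0%N * b 2%N;
                   a 0%N * b 1%N - a 1%N * b 0%N]`_i.

(* [`|u|] is the maximum norm on matrices. *)
Definition euclidean_norm u : R := Num.sqrt (\sum_i u i ord0 ^+ 2).

Definition normal_field w f (x : 'cV[R]_2) : 'cV[R]_3 :=
  let c := cross (cpartial w ord0 f x) (cpartial w ord_max f x) in
  (euclidean_norm c)^-1 *: c.

End surfaces.

(* Main.v *)
Require Import Defs.
From mathcomp Require Import all_boot all_order all_algebra ring lra.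
From mathcomp Require Import all_classical all_reals all_analysis.

(** Write E, F, G for the common metric of the two surfaces.  As the metrics and
    the normals agree, at every point the frame of [m] is obtained from the frame
    of [y0] by a rotation about the common normal; its cosine is
    c = <m_1, y0_1> / E.  By Koszul's formula the tangential components of the
    second derivatives are the same for both surfaces, and differentiating
    <m_1, y0_1> shows that c has vanishing gradient, so it is constant.
    The Jacobians satisfy |(Dm - Dy0) v|^2 = 2 (1 - c) |Dy0 v|^2.  If c = 1, then
    [m - y0] is constant, and it vanishes on [gd].  If c <> 1, then [Dm - Dy0] is
    injective at a point p of [gd]; some scalar projection of [m - y0] then has
    as its gradient at p the horizontal direction of the local graph, so it
    cannot vanish at all nearby points of that Lipschitz graph. *)

Import Order.TTheory GRing.Theory Num.Theory.
Import numFieldNormedType.Exports.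

Local Open Scope classical_set_scope.
Local Open Scope ring_scope.

(** * Mean value arguments for directional derivatives *)

Section directional_derivatives.
Context {R : realType} {V : normedModType R}.
Implicit Types (f df fu fv : V -> R) (x u v : V).

Lemma is_derive_line f x v (s l : R) : is_derive (x + s *: v) v f l ->
  is_derive s 1 (fun t : R => f (x + t *: v)) l.
Proof.
have E : (fun h : R => h^-1 *: (((fun t : R => f (x + t *: v)) \o shift s)
             (h *: 1) - f (x + s *: v))) =
  (fun h : R => h^-1 *: ((f \o shift (x + s *: v)) (h *: v) - f (x + s *: v))).
  apply/funext => h /=; congr (_ *: (f _ - _)).
  have -> : h *: 1 = h :> R by rewrite /GRing.scale /= mulr1.
  by rewrite scalerDl addrCA.
by move=> [df <-]; split; rewrite /derivable /derive E.
Qed.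

Lemma is_derive_translate f x u v (l : R) : is_derive (x + u) v f l ->
  is_derive x v (fun y => f (y + u)) l.
Proof.
have E : (fun h : R => h^-1 *: (((fun y => f (y + u)) \o shift x)
             (h *: v) - f (x + u))) =
  (fun h : R => h^-1 *: ((f \o shift (x + u)) (h *: v) - f (x + u))).
  by apply/funext => h /=; rewrite addrA.
by move=> [df <-]; split; rewrite /derivable /derive E.
Qed.

Lemma cvg_is_derive f x v (l : R) :
  (fun h : R => h^-1 *: ((f \o shift x) (h *: v) - f x)) @ 0^' --> l ->
  is_derive x v f l.
Proof.
by move=> lim; split; [apply/cvg_ex; exists l | exact: cvg_lim lim].
Qed.

Lemma MVT_line f df x v (t : R) :
  (forall s : R, `|s| <= `|t| -> is_derive (x + s *: v) v f (df (x + s *: v))) ->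
  exists2 s : R, `|s| <= `|t| & f (x + t *: v) - f x = t * df (x + s *: v).
Proof.
move=> fdf; pose g s := f (x + s *: v); pose dg s := df (x + s *: v).
have gcont (a b : R) : (forall s, s \in `[a, b] -> `|s| <= `|t|) ->
    {within `[a, b], continuous g}.
  move=> ab; apply: derivable_within_continuous => s /ab /fdf /is_derive_line.
  by case.
have gE : g 0 = f x by rewrite /g scale0r addr0.
have [t0|/ltW t0] := leP 0 t.
  have ab s : s \in `[0, t] -> `|s| <= `|t|.
    by rewrite in_itv /= => /andP[s0 st]; rewrite !ger0_norm.
  have [||s /ab st E] := @MVT_segment R g dg 0 t t0.
  - by move=> s /subset_itv_oo_cc /ab /fdf /is_derive_line.
  - exact: gcont.
  by exists s => //; rewrite -gE E subr0 mulrC.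
have ab s : s \in `[t, 0] -> `|s| <= `|t|.
  by rewrite in_itv /= => /andP[ts s0]; rewrite !ler0_norm // lerN2.
have [||s /ab st E] := @MVT_segment R g dg t 0 t0.
- by move=> s /subset_itv_oo_cc /ab /fdf /is_derive_line.
- exact: gcont.
exists s => //; rewrite -gE -/(g t); apply: oppr_inj.
by rewrite opprB E sub0r mulrN mulrC.
Qed.

Lemma nbhs_parallelogram x u v (P : set V) : nbhs x P ->
  exists2 r : R, 0 < r & forall a b : R, `|a| < r -> `|b| < r ->
    P (x + a *: u + b *: v).
Proof.
move=> /nbhs_ballP[r /= r0 rP]; have K0 : 0 < `|u| + `|v| + 1.
  by apply: ltr_wpDl; rewrite ?addr_ge0.
exists (r / (`|u| + `|v| + 1)); first exact: divr_gt0.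
move=> a b ar br; apply: rP; rewrite -ball_normE /ball_ /=.
rewrite -addrA opprD addrA subrr sub0r normrN.
apply: le_lt_trans (ler_normD _ _) _; rewrite !normrZ.
apply: (@le_lt_trans _ _ (r / (`|u| + `|v| + 1) * (`|u| + `|v|))).
  by rewrite mulrDr; apply: lerD; apply: ler_wpM2r => //; exact: ltW.
by rewrite mulrAC ltr_pdivrMr // ltr_pM2l // ltrDl.
Qed.

(** The mean value theorem is applied twice: along [u] to the increment [g] of [f] in direction [v],
    then along [v] to [fu]. *)
Lemma second_difference f fu fuv x u v (t : R) :
  (forall a b : R, `|a| <= `|t| -> `|b| <= `|t| ->
     let y := x + a *: u + b *: v in
     is_derive y u f (fu y) /\ is_derive y v fu (fuv y)) ->
  exists a b : R, [/\ `|a| <= `|t|, `|b| <= `|t| &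
    f (x + t *: u + t *: v) - f (x + t *: u) - (f (x + t *: v) - f x) =
    t * t * fuv (x + a *: u + b *: v)].
Proof.
move=> df; pose g y := f (y + t *: v) - f y.
pose dg y := fu (y + t *: v) - fu y.
have gdg a : `|a| <= `|t| -> is_derive (x + a *: u) u g (dg (x + a *: u)).
  move=> ta; apply: is_deriveB.
    by apply: is_derive_translate; exact: (df a t ta (lexx _)).1.
  have t0 : `|0 : R| <= `|t| by rewrite normr0.
  by have [+ _] := df a 0 ta t0; rewrite scale0r addr0; apply.
have [a ta gE] := MVT_line g dg x u t gdg.
have [|b tb E] := MVT_line fu fuv (x + a *: u) v t.
  by move=> b tb; exact: (df a b ta tb).2.
exists a, b; split=> //; rewrite -/(g (x + t *: u)) -/(g x) gE.
by rewrite /dg E mulrA.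
Qed.

(* Schwarz' theorem: both mixed derivatives are limits of the same second
   difference quotient. *)
Lemma derive_comm f fu fv fuv fvu x u v :
  (\forall y \near x, is_derive y u f (fu y)) ->
  (\forall y \near x, is_derive y v f (fv y)) ->
  (\forall y \near x, is_derive y v fu (fuv y)) ->
  (\forall y \near x, is_derive y u fv (fvu y)) ->
  {for x, continuous fuv} -> {for x, continuous fvu} -> fuv x = fvu x.
Proof.
move=> du dv duv dvu cuv cvu; apply/eqP; rewrite -subr_eq0 -normr_le0.
apply/ler_addgt0Pr => e e0; rewrite add0r.
have e20 : 0 < e / 2 by rewrite divr_gt0.
have near1 : \forall y \near x, `|fuv x - fuv y| < e / 2.
  by move/cvgrPdist_lt: cuv; apply.
have near2 : \forall y \near x, `|fvu x - fvu y| < e / 2.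
  by move/cvgrPdist_lt: cvu; apply.
have [r r0 rP] := nbhs_parallelogram x u v _ (filterI
  (filterI (filterI du duv) (filterI dv dvu)) (filterI near1 near2)).
pose t := r / 2; have t0 : 0 < t by rewrite divr_gt0.
have tr : `|t| < r by rewrite gtr0_norm // /t; lra.
have small a b : `|a| <= `|t| -> `|b| <= `|t| -> `|a| < r /\ `|b| < r.
  by move=> ta tb; split; apply: le_lt_trans tr.
have [|a1 [b1 [/small sa1 /sa1[ra1 rb1] E1]]] :=
    second_difference f fu fuv x u v t.
  by move=> a b /small sa /sa[ra rb]; have [[[]]] := rP a b ra rb.
have [|a2 [b2 [/small sa2 /sa2[ra2 rb2] E2]]] :=
    second_difference f fv fvu x v u t.
  move=> a b /small sa /sa[ra rb]; have [[_ +] _] := rP b a rb ra.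
  by rewrite /= addrAC.
have {E1 E2} E : fuv (x + a1 *: u + b1 *: v) = fvu (x + a2 *: v + b2 *: u).
  have tt0 : t * t != 0 by rewrite mulf_neq0 // gt_eqF.
  apply: (mulfI tt0); rewrite -[LHS]E1 -[RHS]E2.
  have -> : x + t *: v + t *: u = x + t *: u + t *: v by rewrite addrAC.
  by ring.
have [_ [n1 _]] := rP a1 b1 ra1 rb1.
have [_ [_ n2]] := rP b2 a2 rb2 ra2.
rewrite addrAC -E in n2; rewrite distrC in n2.
apply: le_trans (ler_distD (fuv (x + a1 *: u + b1 *: v)) _ _) _.
by rewrite [leRHS]splitr; apply: lerD; [exact: (ltW n1)|exact: (ltW n2)].
Qed.

(** Directional derivatives alone need not be linear in the direction. The increment is split into a
    leg along [u] and a leg along [v]; the mean value theorem on each leg and continuity of [fu] and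
    [fv] at [x] give the linear formula. *)
Lemma is_derive_lincomb f fu fv x u v (a b : R) :
  (\forall y \near x, is_derive y u f (fu y)) ->
  (\forall y \near x, is_derive y v f (fv y)) ->
  {for x, continuous fu} -> {for x, continuous fv} ->
  is_derive x (a *: u + b *: v) f (a * fu x + b * fv x).
Proof.
move=> du dv cu cv.
apply: cvg_is_derive; apply/cvgrPdist_le => e e0.
have K0 : 0 < `|a| + `|b| + 1 by apply: ltr_wpDl; rewrite ?addr_ge0.
have d0 : 0 < e / (`|a| + `|b| + 1) by exact: divr_gt0.
set d := e / _ in d0.
have near1 : \forall y \near x, `|fu x - fu y| < d.
  by move/cvgrPdist_lt: cu; apply.
have near2 : \forall y \near x, `|fv x - fv y| < d.
  by move/cvgrPdist_lt: cv; apply.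
have [r r0 rP] := nbhs_parallelogram x u v _
  (filterI (filterI du dv) (filterI near1 near2)).
have r'0 : 0 < r / (`|a| + `|b| + 1) by exact: divr_gt0.
exists (r / (`|a| + `|b| + 1)) => //= h /=; rewrite add0r normrN => hr h0.
have sa : `|h * a| < r.
  rewrite normrM; apply: (@le_lt_trans _ _ (`|h| * (`|a| + `|b| + 1))).
    by apply: ler_wpM2l => //; have := normr_ge0 b; lra.
  by rewrite -ltr_pdivlMr.
have sb : `|h * b| < r.
  rewrite normrM; apply: (@le_lt_trans _ _ (`|h| * (`|a| + `|b| + 1))).
    by apply: ler_wpM2l => //; have := normr_ge0 a; lra.
  by rewrite -ltr_pdivlMr.
have r0' : `|0 : R| < r by rewrite normr0.
have [|s /le_lt_trans/(_ sa) sr Es] := MVT_line f fu x u (h * a).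
  move=> s /le_lt_trans/(_ sa) sr; have [[+ _] _] := rP s 0 sr r0'.
  by rewrite scale0r addr0; apply.
have [|q /le_lt_trans/(_ sb) qr Eq] :=
    MVT_line f fv (x + (h * a) *: u) v (h * b).
  by move=> q /le_lt_trans/(_ sb) qr; exact: (rP _ q sa qr).1.2.
have [_ [n1 _]] := rP s 0 sr r0'; rewrite scale0r addr0 in n1.
have [_ [_ n2]] := rP _ q sa qr.
have -> : h *: (a *: u + b *: v) + x = x + (h * a) *: u + (h * b) *: v.
  by rewrite scalerDr !scalerA addrC addrA.
have -> : f (x + (h * a) *: u + (h * b) *: v) - f x =
  h * (a * fu (x + s *: u) + b * fv (x + (h * a) *: u + q *: v)).
  rewrite -[LHS](subrKA (f (x + (h * a) *: u))) Eq Es; ring.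
set p1 := fu (x + _) in n1 *; set p2 := fv (x + _ + _) in n2 *.
have -> : h^-1 *: (h * (a * p1 + b * p2)) = a * p1 + b * p2.
  by rewrite [LHS]mulKf.
have -> (c1 c2 : R) : a * c1 + b * c2 - (a * p1 + b * p2) =
  a * (c1 - p1) + b * (c2 - p2) by ring.
apply: le_trans (ler_normD _ _) _; rewrite !normrM.
apply: (@le_trans _ _ (`|a| * d + `|b| * d)).
  by apply: lerD; apply: ler_wpM2l => //; [exact: (ltW n1)|exact: (ltW n2)].
rewrite -mulrDl /d mulrCA ler_piMr ?(ltW e0) //.
by rewrite ler_pdivrMr // mul1r lerDl.
Qed.

End directional_derivatives.

(** * Functions with vanishing partial derivatives on a plane domain *)

Lemma ord2P (i : 'I_2) : i = ord0 \/ i = ord_max.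
Proof. by case: i => [[|[|//]] lti]; [left|right]; exact: val_inj. Qed.

Lemma cV2_decomp (R : realType) (x z : 'cV[R]_2) :
  z = x + (z - x) ord0 ord0 *: delta_mx ord0 ord0
        + (z - x) ord_max ord0 *: delta_mx ord_max ord0.
Proof.
by apply/colP => i; rewrite !mxE /=; case: (ord2P i) => -> /=; ring.
Qed.

(** Nearby points are joined by one leg along each axis, so [c] is locally constant; its level sets
    are then open and closed relative to [w]. *)
Lemma derive0_cst (R : realType) (w : set 'cV[R]_2) (c : 'cV[R]_2 -> R) :
  open w -> connected w ->
  (forall x i, w x -> is_derive x (delta_mx i ord0) c 0) ->
  forall x y, w x -> w y -> c x = c y.
Proof.
move=> ow cw dc x y wx wy.
have loc z : w z -> \forall z' \near z, w z' /\ c z' = c z.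
  move=> wz; have nw : nbhs z w by exact: open_nbhs_nbhs.
  have [r r0 inw] := @nbhs_parallelogram R 'cV[R]_2 z (delta_mx ord0 ord0)
    (delta_mx ord_max ord0) w nw.
  apply/nbhs_ballP; exists r => // z' [_ zz'].
  have sm i : `|(z' - z) i ord0| < r.
    by rewrite !mxE distrC; apply: zz'.
  rewrite (cV2_decomp _ z z'); set a := (z' - z) ord0 ord0.
  set b := (z' - z) ord_max ord0; have := sm ord0; have := sm ord_max.
  rewrite -/a -/b => br ar; split; first exact: inw.
  have inw0 s : `|s| < r -> w (z + s *: delta_mx ord0 ord0).
    move=> sr; rewrite -[_ + _ *: _]addr0 -(scale0r (delta_mx ord_max ord0)).
    by apply: inw; rewrite ?normr0.
  have [|s _] :=
      @MVT_line R _ c (fun=> 0) z (delta_mx ord0 ord0) a.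
    by move=> s /le_lt_trans/(_ ar)/inw0/(dc _ ord0).
  rewrite mulr0 => E1.
  have [|q _] := @MVT_line R _ c (fun=> 0)
      (z + a *: delta_mx ord0 ord0) (delta_mx ord_max ord0) b.
    by move=> q /le_lt_trans/(_ br) qr; exact: dc _ ord_max (inw _ _ ar qr).
  rewrite mulr0 => E2.
  by apply: subr0_eq; rewrite -(subrKA (c (z + a *: delta_mx ord0 ord0)))
    E1 E2 addr0.
have wE : w `&` [set z | w z /\ c z = c x] = w.
  apply: cw.
  - by exists x.
  - exists [set z | w z /\ c z = c x] => //.
    rewrite openE => z [wz zx]; apply: filterS (loc z wz) => z' [wz' E].
    by split=> //; rewrite E.
  (* Relative closedness: the level set is [w] minus the open set where [c] takes another value. *)
  - exists (~` [set z | w z /\ c z <> c x]).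
      apply: open_closedC; rewrite openE => z [wz zx].
      by apply: filterS (loc z wz) => z' [wz' E]; split=> //; rewrite E.
    apply/seteqP; split=> z /= [wz].
      by move=> [_ zx]; split=> // -[_].
    by move=> zx; split=> //; split=> //; apply: contrapT => nzx; apply: zx.
by have [_ [_ ->]] : (w `&` [set z | w z /\ c z = c x]) y by rewrite wE.
Qed.

(** * Vector algebra in space, and pairs of frames with the same metric and normal *)

Section dot_product.
Context {R : realType}.
Implicit Types (u v y : 'cV[R]_3).

Definition dot u v : R := \sum_i u i ord0 * v i ord0.

Lemma big_ord3 (F : 'I_3 -> R) :
  \sum_i F i = F (inord 0) + F (inord 1) + F (inord 2).
Proof.
rewrite !big_ord_recl big_ord0 addr0 addrA.
by congr (F _ + F _ + F _); apply: val_inj; rewrite /= inordK.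
Qed.

Lemma dotE u v : dot u v = u (inord 0) ord0 * v (inord 0) ord0
  + u (inord 1) ord0 * v (inord 1) ord0 + u (inord 2) ord0 * v (inord 2) ord0.
Proof. exact: big_ord3. Qed.

Lemma crossE u v :
  [/\ cross u v (inord 0) ord0 = u (inord 1) ord0 * v (inord 2) ord0
                                 - u (inord 2) ord0 * v (inord 1) ord0,
      cross u v (inord 1) ord0 = u (inord 2) ord0 * v (inord 0) ord0
                                 - u (inord 0) ord0 * v (inord 2) ord0 &
      cross u v (inord 2) ord0 = u (inord 0) ord0 * v (inord 1) ord0
                                 - u (inord 1) ord0 * v (inord 0) ord0].
Proof. by split; rewrite mxE inordK. Qed.

Lemma dotC u v : dot u v = dot v u.
Proof. by apply: eq_bigr => i _; rewrite mulrC. Qed.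

Lemma dotDr u v y : dot u (v + y) = dot u v + dot u y.
Proof. by rewrite -big_split; apply: eq_bigr => i _; rewrite mxE mulrDr. Qed.

Lemma dotZr u (a : R) v : dot u (a *: v) = a * dot u v.
Proof. by rewrite mulr_sumr; apply: eq_bigr => i _; rewrite mxE mulrCA. Qed.

Lemma dot0r u : dot u 0 = 0.
Proof. by rewrite -(scale0r 0) dotZr mul0r. Qed.

Lemma dotNr u v : dot u (- v) = - dot u v.
Proof. by rewrite -scaleN1r dotZr mulN1r. Qed.

Lemma dotBr u v y : dot u (v - y) = dot u v - dot u y.
Proof. by rewrite dotDr dotNr. Qed.

Lemma dot0_eq0 u : dot u u = 0 -> u = 0.
Proof.
move/eqP; rewrite psumr_eq0 => [/allP u0|i _]; last exact: sqr_ge0.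
apply/colP => i; rewrite mxE; apply/eqP.
by have := u0 i (mem_index_enum i); rewrite /= -expr2 sqrf_eq0.
Qed.

Lemma dot_ge0 u : 0 <= dot u u.
Proof. by apply: sumr_ge0 => i _; exact: sqr_ge0. Qed.

Lemma dot_cross_l u v : dot u (cross u v) = 0.
Proof. by rewrite dotE; case: (crossE u v) => -> -> ->; ring. Qed.

Lemma dot_cross_r u v : dot v (cross u v) = 0.
Proof. by rewrite dotE; case: (crossE u v) => -> -> ->; ring. Qed.

(** Antisymmetry of the scalar triple product; it cancels the rotated components when two frames are
    compared. *)
Lemma dot_cross_swap u v y : dot u (cross y v) = - dot v (cross y u).
Proof.
rewrite !dotE; case: (crossE y v) => -> -> ->.
by case: (crossE y u) => -> -> ->; ring.
Qed.

(** Lagrange's identity: the length of the normal is determined by the metric. *)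
Lemma dot_cross_cross u v :
  dot (cross u v) (cross u v) = dot u u * dot v v - dot u v ^+ 2.
Proof. by rewrite !dotE; case: (crossE u v) => -> -> ->; ring. Qed.

Lemma cross_cross u v y : cross (cross u v) y = dot u y *: v - dot v y *: u.
Proof.
have [E0 E1 E2] := crossE u v; have [F0 F1 F2] := crossE (cross u v) y.
apply/colP => i; rewrite -[i]inord_val; case: i => [[|[|[|//]]] lti] /=;
by rewrite ?F0 ?F1 ?F2 ?E0 ?E1 ?E2 !mxE !dotE; ring.
Qed.

(* The orthogonal expansion along [u], [n x u] and [n := u x v]. *)
Lemma dot_cross_frame u v y z (n := cross u v) :
  dot u u * dot n n * dot y z = dot n n * dot y u * dot z u
    + dot y (cross n u) * dot z (cross n u) + dot u u * dot y n * dot z n.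
Proof.
have [N0 N1 N2] := crossE n u; have [M0 M1 M2] := crossE u v.
rewrite !dotE N0 N1 N2 M0 M1 M2.
by move: (u _ _) (u _ _) (u _ _) (v _ _) (v _ _) (v _ _) (y _ _) (y _ _) (y _ _)
  (z _ _) (z _ _) (z _ _) => *; ring.
Qed.

Section isometric_frames.
Variables (m1 m2 y1 y2 : 'cV[R]_3).
Hypotheses (eqE : dot m1 m1 = dot y1 y1) (eqF : dot m1 m2 = dot y1 y2)
  (eqG : dot m2 m2 = dot y2 y2) (eqN : cross m1 m2 = cross y1 y2)
  (E0 : dot y1 y1 != 0) (N0 : dot (cross y1 y2) (cross y1 y2) != 0).

Let frame_y y z (n := cross y1 y2) : dot y1 y1 * dot n n * dot y z =
  dot n n * dot y y1 * dot z y1 + dot y (cross n y1) * dot z (cross n y1)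
    + dot y1 y1 * dot y n * dot z n.
Proof. exact: dot_cross_frame. Qed.

Let frame_m y z (n := cross y1 y2) : dot y1 y1 * dot n n * dot y z =
  dot n n * dot y m1 * dot z m1 + dot y (cross n m1) * dot z (cross n m1)
    + dot y1 y1 * dot y n * dot z n.
Proof. by have := dot_cross_frame m1 m2 y z; rewrite eqN eqE. Qed.

(** The rotated vectors [n x y1] and [n x m1] are combinations of their own tangent frames with the
    same coefficients. *)
Let turn_y y : dot y (cross (cross y1 y2) y1) =
  dot y1 y1 * dot y y2 - dot y1 y2 * dot y y1.
Proof. by rewrite cross_cross dotBr !dotZr (dotC y2 y1). Qed.

Let turn_m y : dot y (cross (cross y1 y2) m1) =
  dot y1 y1 * dot y m2 - dot y1 y2 * dot y m1.
Proof. by rewrite -eqN cross_cross dotBr !dotZr (dotC m2 m1) eqE eqF. Qed.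

Let normal_m1 : dot m1 (cross y1 y2) = 0.
Proof. by rewrite -eqN dot_cross_l. Qed.

Let normal_m2 : dot m2 (cross y1 y2) = 0.
Proof. by rewrite -eqN dot_cross_r. Qed.

(** The triple product of [m2], the common normal [n] and [y1] is expanded both as [m2 . (n x y1)]
    and as [- y1 . (n x m2)]; the terms in [dot m2 y1] cancel. *)
Lemma frame_gram22 : dot y1 y1 * dot m2 y2 = dot y2 y2 * dot m1 y1.
Proof.
have := dot_cross_swap m2 y1 (cross y1 y2); rewrite turn_y.
have -> : dot y1 (cross (cross y1 y2) m2) =
    dot y1 y2 * dot m2 y1 - dot y2 y2 * dot m1 y1.
  rewrite -eqN cross_cross dotBr !dotZr eqF eqG.
  by rewrite (dotC y1 m2) (dotC y1 m1).
by move=> ?; lra.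
Qed.

(** [dot m1 y2] is expanded along the frame of [y1], and [dot m2 y1] along that of [m1]. The rotated
    components cancel: their first factors are opposite by [dot_cross_swap], their second factors
    both equal the Gram determinant. *)
Lemma frame_gram12 :
  dot y1 y1 * (dot m1 y2 + dot m2 y1) = 2 * dot y1 y2 * dot m1 y1.
Proof.
apply: (mulfI N0); rewrite (dotC m2 y1) mulrCA mulrA mulrDr frame_y frame_m.
rewrite (dot_cross_swap m1) normal_m1 normal_m2 !turn_m turn_y.
rewrite eqG (dotC y2 y1) (dotC m2 m1) eqF (dotC y1 m1).
by rewrite dot_cross_cross; ring.
Qed.

(** With [a] and [b] the derivatives of [m1] and [y1], this says that [dot m1 y1 / dot y1 y1] has
    derivative zero. The hypotheses give [a] and [b] the same rotated components, which cancel as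
    before; the normal parts vanish because [y1] and [m1] are tangent. *)
Lemma frame_derive (a b : 'cV[R]_3) :
  dot a m1 = dot b y1 -> dot a m2 = dot b y2 ->
  dot y1 y1 * (dot a y1 + dot m1 b) = 2 * dot b y1 * dot m1 y1.
Proof.
move=> ab1 ab2.
apply: (mulfI N0); rewrite mulrCA mulrA mulrDr (frame_m a) (frame_y m1).
rewrite (dot_cross_swap m1) normal_m1 dot_cross_l !turn_m turn_y.
by rewrite ab1 ab2 (dotC y1 m1); ring.
Qed.

End isometric_frames.
End dot_product.

(** * Derivatives and boundary limits of maps that are [C^2] up to the boundary *)

Lemma is_derive_coord (R : realType) (V : normedModType R) (n : nat)
    (f : V -> 'cV[R]_n.+1) (x v : V) (l : 'cV[R]_n.+1) (k : 'I_n.+1) :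
  is_derive x v f l -> is_derive x v (fun y => f y k ord0) (l k ord0).
Proof.
move=> [df <-]; split; first by move/derivable_mxP: df; apply.
by rewrite derive_mx // mxE.
Qed.

Lemma is_derive_dot (R : realType) (V : normedModType R)
    (f g : V -> 'cV[R]_3) (x v : V) (df dg : 'cV[R]_3) :
  is_derive x v f df -> is_derive x v g dg ->
  is_derive x v (fun y => dot (f y) (g y)) (dot df (g x) + dot (f x) dg).
Proof.
move=> fdf gdg.
have -> : (fun y => dot (f y) (g y)) =
    \sum_i ((fun y => f y i ord0) * (fun y => g y i ord0)).
  by apply/funext => y; rewrite fct_sumE.
have -> : dot df (g x) + dot (f x) dg =
    \sum_i (f x i ord0 *: dg i ord0 + g x i ord0 *: df i ord0).
  rewrite -big_split; apply: eq_bigr => i _.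
  by rewrite addrC [df _ _ * _]mulrC.
by apply: is_derive_sum => i; apply: is_deriveM; exact: is_derive_coord.
Qed.

Lemma is_derive_unique (R : realType) (V W : normedModType R) (f : V -> W)
  (x v : V) (a b : W) : is_derive x v f a -> is_derive x v f b -> a = b.
Proof. by move=> [_ <-] [_ <-]. Qed.

Section C2_maps.
Context {R : realType} (w : set 'cV[R]_2) (n : nat).
Implicit Types f : 'cV[R]_2 -> 'cV[R]_n.+1.
Hypothesis ow : open w.

Lemma extends_continuous f x :
  extends_continuously w f -> w x -> {for x, continuous f}.
Proof.
move=> [F cF Ff] wx.
have nw : \forall y \near x, w y by exact: open_nbhs_nbhs.
have cx : closure w x by exact: subset_closure.
have : F @ x --> F x.
  move/subspace_continuousP: cF => /(_ x cx).
  rewrite within_interior //; apply: interiorS nw; exact: subset_closure.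
rewrite (Ff x wx) => cFx; rewrite /prop_for /continuous_at.
apply: cvg_trans cFx; apply: (@near_eq_cvg _ _ (nbhs x)).
by apply: filterS nw => y /Ff.
Qed.

(** Ensures that the [lim] defining [cpartial] is a true limit at every point of the closure, not a
    default value. *)
Lemma extends_cvg f x : extends_continuously w f -> closure w x ->
  f z @[z --> within w (nbhs x)] --> lim (f z @[z --> within w (nbhs x)]).
Proof.
move=> [F cF Ff] cx.
have FF : ProperFilter (within w (nbhs x)) by exact: within_nbhs_proper.
suff /cvgP : f z @[z --> within w (nbhs x)] --> F x by [].
have : F z @[z --> within w (nbhs x)] --> F x.
  move/subspace_continuousP: cF => /(_ x cx) cFx.
  apply: cvg_trans cFx; apply: cvg_app; apply: within_subset.
  exact: subset_closure.
apply: cvg_trans; apply: (@near_eq_cvg _ _ (within w (nbhs x))).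
by apply: filterS (withinT w _) => y /Ff.
Qed.

Context {f : 'cV[R]_2 -> 'cV[R]_n.+1}.
Hypothesis C2f : Ck_closure 2 w f.

Lemma partial_cvg i x : closure w x ->
  partial i f z @[z --> within w (nbhs x)] --> cpartial w i f x.
Proof. by apply: extends_cvg; have [_ _ /(_ [:: i])] := C2f; apply. Qed.

Lemma partial_continuous i x : w x -> {for x, continuous (partial i f)}.
Proof. by apply: extends_continuous; have [_ _ /(_ [:: i])] := C2f; apply. Qed.

Lemma partial2_continuous i j x : w x ->
  {for x, continuous (partial j (partial i f))}.
Proof. by apply: extends_continuous; have [_ _ /(_ [:: j; i])] := C2f; apply. Qed.

Lemma cpartial_in i x : w x -> cpartial w i f x = partial i f x.
Proof.
move=> wx; rewrite /cpartial within_interior; last first.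
  exact: open_nbhs_nbhs.
exact/cvg_lim/partial_continuous.
Qed.

Lemma is_derive_partial i x : w x ->
  is_derive x (delta_mx i ord0) f (partial i f x).
Proof.
by move=> wx; apply: derivableP; have [_ /(_ [::] i x isT wx)] := C2f.
Qed.

Lemma is_derive_partial2 i j x : w x ->
  is_derive x (delta_mx j ord0) (partial i f) (partial j (partial i f) x).
Proof.
by move=> wx; apply: derivableP; have [_ /(_ [:: i] j x isT wx)] := C2f.
Qed.

Lemma partial_comm i j x : w x ->
  partial j (partial i f) x = partial i (partial j f) x.
Proof.
move=> wx; apply/colP => k.
have nw : \forall y \near x, w y by exact: open_nbhs_nbhs.
have coordc (g : 'cV[R]_2 -> 'cV[R]_n.+1) : {for x, continuous g} ->
    {for x, continuous (fun y => g y k ord0 : R)}.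
  move=> cg; apply: (@continuous_comp _ _ _ g (fun M => M k ord0)) => //.
  exact: coord_continuous.
apply: (derive_comm (fun y => f y k ord0) (fun y => partial i f y k ord0)
  (fun y => partial j f y k ord0) (fun y => partial j (partial i f) y k ord0)
  (fun y => partial i (partial j f) y k ord0) x (delta_mx i ord0)
  (delta_mx j ord0)).
- by apply: filterS nw => y wy; apply/is_derive_coord/is_derive_partial.
- by apply: filterS nw => y wy; apply/is_derive_coord/is_derive_partial.
- by apply: filterS nw => y wy; apply/is_derive_coord/is_derive_partial2.
- by apply: filterS nw => y wy; apply/is_derive_coord/is_derive_partial2.
- exact/coordc/partial2_continuous.
- exact/coordc/partial2_continuous.
Qed.

End C2_maps.

Lemma closure_eq0 (R : realType) (w : set 'cV[R]_2) (n : nat)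
    (f g : 'cV[R]_2 -> 'cV[R]_n.+1) :
  {within closure w, continuous f} -> {within closure w, continuous g} ->
  (forall x, w x -> f x = g x) -> forall x, closure w x -> f x = g x.
Proof.
move=> /subspace_continuousP cf /subspace_continuousP cg fg x cx.
have FF : ProperFilter (within w (nbhs x)) by exact: within_nbhs_proper.
have ww : within w (nbhs x) `=>` within (closure w) (nbhs x).
  by apply: within_subset; exact: subset_closure.
have fx : f z @[z --> within w (nbhs x)] --> f x.
  by apply: cvg_trans (cf x cx); apply: cvg_app.
have gx : g z @[z --> within w (nbhs x)] --> g x.
  by apply: cvg_trans (cg x cx); apply: cvg_app.
apply: (cvg_unique (@norm_hausdorff _ _) fx).
apply: cvg_trans gx; apply: (@near_eq_cvg _ _ (within w (nbhs x))).
by apply: filterS (withinT w _) => y wy; rewrite fg.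
Qed.

Lemma cvg_dot (R : realType) (T : Type) (F : set_system T) {FF : Filter F}
    (f g : T -> 'cV[R]_3) (a b : 'cV[R]_3) :
  f @ F --> a -> g @ F --> b -> (fun y => dot (f y) (g y)) @ F --> dot a b.
Proof.
move=> fa gb.
have coord (h : T -> 'cV[R]_3) (c : 'cV[R]_3) i : h @ F --> c ->
    (fun y => h y i ord0 : R) @ F --> (c i ord0 : R).
  move=> hc; exact: (@cvg_comp _ _ _ h (fun M : 'cV[R]_3 => M i ord0) F _ _ hc
    (@coord_continuous R 3 1 i ord0 c)).
rewrite dotE; have -> : (fun y => dot (f y) (g y)) =
    (fun y => f y (inord 0) ord0 * g y (inord 0) ord0
            + f y (inord 1) ord0 * g y (inord 1) ord0
            + f y (inord 2) ord0 * g y (inord 2) ord0).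
  by apply/funext => y; rewrite dotE.
by apply: cvgD; [apply: cvgD|]; apply: cvgM; exact: coord.
Qed.

(** * Gram matrices and normals of regular surfaces *)

Lemma jacobi_gram (R : realType) (w : set 'cV[R]_2) f x i j :
  ((jacobi w f x)^T *m jacobi w f x) i j = dot (cpartial w i f x) (cpartial w j f x).
Proof. by rewrite mxE; apply: eq_bigr => k _; rewrite !mxE. Qed.

Lemma jacobi_mul (R : realType) (w : set 'cV[R]_2) f x (v : 'cV[R]_2) :
  jacobi w f x *m v = v ord0 ord0 *: cpartial w ord0 f x
    + v ord_max ord0 *: cpartial w ord_max f x.
Proof.
apply/colP => k; rewrite [LHS]mxE big_ord_recl big_ord1 [RHS]mxE.
have -> : lift ord0 ord0 = ord_max :> 'I_2 by exact: val_inj.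
by congr (_ + _); rewrite [RHS]mxE mulrC; congr (_ * _); rewrite [LHS]mxE.
Qed.

Lemma regular_free (R : realType) (w : set 'cV[R]_2) f x (v : 'cV[R]_2) :
  \rank (jacobi w f x) = 2%N -> jacobi w f x *m v = 0 -> v = 0.
Proof.
move=> rk /(congr1 trmx); rewrite trmx_mul trmx0 => /eqP.
rewrite mulmx_free_eq0; last by rewrite /row_free mxrank_tr rk.
by rewrite trmx_eq0 => /eqP.
Qed.

Lemma free_gram (R : realType) (u v : 'cV[R]_3) :
  (forall a b : R, a *: u + b *: v = 0 -> a = 0 /\ b = 0) ->
  dot u u != 0 /\ dot (cross u v) (cross u v) != 0.
Proof.
move=> free; have E0 : dot u u != 0.
  apply/eqP => /dot0_eq0 u0.
  have [] := free 1 0; first by rewrite u0 scaler0 scale0r addr0.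
  by move/eqP; rewrite oner_eq0.
split=> //; apply/eqP => D0.
(* By Lagrange's identity this combination has squared length [dot u u] times that of [cross u v],
   hence zero; but its second coefficient [dot u u] is nonzero. *)
suff /free[_ /eqP] : - dot u v *: u + dot u u *: v = 0 by rewrite (negbTE E0).
apply: dot0_eq0; transitivity (dot u u * dot (cross u v) (cross u v)).
  by rewrite dot_cross_cross !dotE !mxE; ring.
by rewrite D0 mulr0.
Qed.

Lemma free_dot (R : realType) (u v : 'cV[R]_3) (s t : R) :
  (forall a b : R, a *: u + b *: v = 0 -> a = 0 /\ b = 0) ->
  exists2 xi : 'cV[R]_3, dot xi u = s & dot xi v = t.
Proof.
move=> /free_gram[_]; set D := dot _ _ => D0.
have DE : D = dot u u * dot v v - dot u v ^+ 2 by exact: dot_cross_cross.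
(* Cramer's rule for the Gram system of [u] and [v], with determinant [D]. *)
exists (((s * dot v v - t * dot u v) / D) *: u
        + ((t * dot u u - s * dot u v) / D) *: v);
rewrite dotC dotDr !dotZr; apply: (mulIf D0); rewrite mulrDl mulrAC divfK //;
rewrite [X in _ + X]mulrAC divfK // DE ?(dotC v u); ring.
Qed.

Lemma regular_cpartial_free (R : realType) (w : set 'cV[R]_2) f x (a b : R) :
  \rank (jacobi w f x) = 2%N ->
  a *: cpartial w ord0 f x + b *: cpartial w ord_max f x = 0 -> a = 0 /\ b = 0.
Proof.
move=> rk ab0; pose v : 'cV[R]_2 := \col_i (if i == ord0 then a else b).
have : v = 0.
  by apply: regular_free rk _; rewrite jacobi_mul [v _ _]mxE [X in _ + X *: _]mxE.
by move=> /colP v0; have := v0 ord0; have := v0 ord_max; rewrite !mxE.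
Qed.

(** The metric fixes the length of the cross product by Lagrange's identity, so the normalising
    factors agree; if that length is zero, both vectors vanish. *)
Lemma cross_of_normal (R : realType) (m1 m2 y1 y2 : 'cV[R]_3)
    (c := cross m1 m2) (d := cross y1 y2) :
  dot m1 m1 = dot y1 y1 -> dot m1 m2 = dot y1 y2 -> dot m2 m2 = dot y2 y2 ->
  (euclidean_norm c)^-1 *: c = (euclidean_norm d)^-1 *: d -> c = d.
Proof.
move=> eqE eqF eqG; have cd : dot c c = dot d d.
  by rewrite !dot_cross_cross eqE eqF eqG.
have normE (u : 'cV[R]_3) : euclidean_norm u = Num.sqrt (dot u u).
  by congr Num.sqrt; apply: eq_bigr => i _; rewrite expr2.
rewrite !normE cd; have [d0|d0] := eqVneq (dot d d) 0.
  by rewrite (dot0_eq0 _ d0); rewrite d0 in cd; rewrite (dot0_eq0 _ cd).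
apply: scalerI; rewrite invr_eq0 sqrtr_eq0 -ltNge lt_neqAle eq_sym d0.
exact: dot_ge0.
Qed.

(** * Constancy of the rotation angle and the size of the gradient difference *)

Section parallel_frames.
Context {R : realType} (w : set 'cV[R]_2) (dm dy : 'I_2 -> 'cV[R]_2 -> 'cV[R]_3)
  (ddm ddy : 'I_2 -> 'I_2 -> 'cV[R]_2 -> 'cV[R]_3).
Hypotheses (ow : open w) (cw : connected w).
Hypothesis dmP : forall i j x, w x ->
  is_derive x (delta_mx j ord0) (dm i) (ddm j i x).
Hypothesis dyP : forall i j x, w x ->
  is_derive x (delta_mx j ord0) (dy i) (ddy j i x).
Hypothesis ddmC : forall i j x, w x -> ddm j i x = ddm i j x.
Hypothesis ddyC : forall i j x, w x -> ddy j i x = ddy i j x.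
Hypothesis gram_eq : forall i j x, w x ->
  dot (dm i x) (dm j x) = dot (dy i x) (dy j x).
Hypothesis cross_eq : forall x, w x ->
  cross (dm ord0 x) (dm ord_max x) = cross (dy ord0 x) (dy ord_max x).
Hypothesis E0 : forall x, w x -> dot (dy ord0 x) (dy ord0 x) != 0.
Hypothesis N0 : forall x (n := cross (dy ord0 x) (dy ord_max x)),
  w x -> dot n n != 0.

(* Koszul's formula: the products of second with first derivatives are
   determined by the derivatives of the metric. *)
Lemma christoffel_eq i j k x : w x ->
  dot (ddm j i x) (dm k x) = dot (ddy j i x) (dy k x).
Proof.
move=> wx; have nw : \forall z \near x, w z by exact: open_nbhs_nbhs.
have dgram i' j' k' :
    dot (ddm j' i' x) (dm k' x) + dot (ddm j' k' x) (dm i' x) =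
    dot (ddy j' i' x) (dy k' x) + dot (ddy j' k' x) (dy i' x).
  rewrite (dotC (ddm j' k' x)) (dotC (ddy j' k' x)).
  apply: (is_derive_unique _ _ _
    (fun z => dot (dm i' z) (dm k' z)) x (delta_mx j' ord0)).
    by apply: is_derive_dot; exact: dmP.
  apply: (@near_eq_is_derive R _ _ (fun z => dot (dy i' z) (dy k' z))).
    by apply: filterS nw => z /gram_eq ->.
  by apply: is_derive_dot; exact: dyP.
(* After the symmetry of second derivatives is used, the first two relations minus the third isolate
   twice the wanted product. *)
have := dgram i j k; have := dgram j i k; have := dgram i k j.
rewrite (ddmC i k) // (ddmC j k) // (ddmC i j) //.
rewrite (ddyC i k) // (ddyC j k) // (ddyC i j) //.
by move=> *; lra.
Qed.

Lemma frame_ratio_cst : exists c : R, forall x, w x ->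
  dot (dm ord0 x) (dy ord0 x) = c * dot (dy ord0 x) (dy ord0 x).
Proof.
have [[x0 wx0]|w0] := pselect (w !=set0); last first.
  by exists 0 => x wx; case: w0; exists x.
pose P x := dot (dm ord0 x) (dy ord0 x); pose E x := dot (dy ord0 x) (dy ord0 x).
have dc x j : w x -> is_derive x (delta_mx j ord0) (fun y => P y / E y) 0.
  move=> wx.
  have dP : is_derive x (delta_mx j ord0) P _ :=
    is_derive_dot _ _ _ _ _ _ _ _ (dmP ord0 j x wx) (dyP ord0 j x wx).
  have dE : is_derive x (delta_mx j ord0) E _ :=
    is_derive_dot _ _ _ _ _ _ _ _ (dyP ord0 j x wx) (dyP ord0 j x wx).
  have dV : is_derive x (delta_mx j ord0) (fun y => (E y)^-1)
      (- E x ^- 2 *: (2 * dot (ddy j ord0 x) (dy ord0 x))).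
    split; first by apply: derivableV; [exact: E0 | case: dE].
    rewrite deriveV; [|exact: E0|by case: dE].
    by have [_ ->] := dE; rewrite (dotC (dy _ _)); congr (_ *: _); ring.
  apply: (is_derive_eq (is_deriveM dP dV)).
  (* [H] reads [E P' = E' P], so the numerator in the quotient rule vanishes. *)
  have H := frame_derive _ _ _ _ (gram_eq ord0 ord0 x wx)
    (gram_eq ord0 ord_max x wx) (cross_eq x wx) (N0 x wx) _ _
    (christoffel_eq ord0 j ord0 x wx) (christoffel_eq ord0 j ord_max x wx).
  rewrite -/(E x) -/(P x) in H.
  apply: (mulfI (E0 x wx)); rewrite mulr0 -/(E x).
  rewrite /GRing.scale /= mulrDr mulrA (mulrCA _ (E x)^-1) H.
  by field; exact: E0.
exists (P x0 / E x0) => x wx; rewrite -(derive0_cst _ _ _ ow cw dc x x0 wx wx0).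
by rewrite divfK // E0.
Qed.

End parallel_frames.

(** The symmetrised products of the [m] frame with the [y] frame are [c] times the metric, so
    expanding the square gives twice the metric minus [2 * c] times it. *)
Lemma frame_defect (R : realType) (m1 m2 y1 y2 : 'cV[R]_3) (c a b : R)
    (u := a *: (m1 - y1) + b *: (m2 - y2)) (v := a *: y1 + b *: y2) :
  dot m1 m1 = dot y1 y1 -> dot m1 m2 = dot y1 y2 -> dot m2 m2 = dot y2 y2 ->
  cross m1 m2 = cross y1 y2 -> dot y1 y1 != 0 ->
  dot (cross y1 y2) (cross y1 y2) != 0 -> dot m1 y1 = c * dot y1 y1 ->
  dot u u = 2 * (1 - c) * dot v v.
Proof.
move=> eqE eqF eqG eqN E0 N0 Pc.
have P22 : dot m2 y2 = c * dot y2 y2.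
  apply: (mulfI E0); rewrite (frame_gram22 m1) // Pc; ring.
have P12 : dot m1 y2 + dot m2 y1 = 2 * c * dot y1 y2.
  apply: (mulfI E0); rewrite (frame_gram12 _ _ _ _ eqE) // Pc; ring.
have -> : dot u u = a ^+ 2 * (dot m1 m1 - 2 * dot m1 y1 + dot y1 y1)
    + 2 * a * b * (dot m1 m2 - (dot m1 y2 + dot m2 y1) + dot y1 y2)
    + b ^+ 2 * (dot m2 m2 - 2 * dot m2 y2 + dot y2 y2).
  by rewrite !dotE !mxE; ring.
have -> : dot v v = a ^+ 2 * dot y1 y1 + 2 * a * b * dot y1 y2
    + b ^+ 2 * dot y2 y2 by rewrite !dotE !mxE; ring.
by rewrite eqE eqF eqG Pc P12 P22; ring.
Qed.

(** The relation defining [c] is found inside [w] and passes to boundary points as a limit of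
    partial derivatives; [frame_defect] thus applies on the whole closure. *)
Lemma gradient_defect (R : realType) (w : set 'cV[R]_2)
    (m y : 'cV[R]_2 -> 'cV[R]_3) :
  open w -> connected w -> Ck_closure 2 w m -> Ck_closure 2 w y ->
  regular_surface w y ->
  (forall x, closure w x ->
     (jacobi w m x)^T *m jacobi w m x = (jacobi w y x)^T *m jacobi w y x) ->
  (forall x, closure w x -> normal_field w m x = normal_field w y x) ->
  exists c : R, forall x (a b : R), closure w x ->
    let u := a *: (cpartial w ord0 m x - cpartial w ord0 y x)
      + b *: (cpartial w ord_max m x - cpartial w ord_max y x) in
    let v := a *: cpartial w ord0 y x + b *: cpartial w ord_max y x in
    dot u u = 2 * (1 - c) * dot v v.
Proof.
move=> ow cw hm hy ry metric_eq normal_eq.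
have gram_eq x i j : closure w x -> dot (cpartial w i m x) (cpartial w j m x) =
    dot (cpartial w i y x) (cpartial w j y x).
  move=> cx; exact: (etrans (esym (jacobi_gram R w m x i j)) (etrans
    (congr1 (fun M : 'M[R]_2 => M i j) (metric_eq x cx))
    (jacobi_gram R w y x i j))).
have cross_eq x : closure w x ->
    cross (cpartial w ord0 m x) (cpartial w ord_max m x) =
    cross (cpartial w ord0 y x) (cpartial w ord_max y x).
  move=> cx; exact: (cross_of_normal _ _ _ _ _ (gram_eq x ord0 ord0 cx)
    (gram_eq x ord0 ord_max cx) (gram_eq x ord_max ord_max cx) (normal_eq x cx)).
have reg x cx := free_gram _ _ _
  (fun a b => regular_cpartial_free R w y x a b (ry x cx)).
have mE x i wx := cpartial_in w _ ow hm i x wx.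
have yE x i wx := cpartial_in w _ ow hy i x wx.
have cl x : w x -> closure w x by exact: subset_closure.
have [||||c Pc] := frame_ratio_cst w (fun i => partial i m)
  (fun i => partial i y) (fun j i => partial j (partial i m))
  (fun j i => partial j (partial i y)) ow cw
  (fun i j x => is_derive_partial2 w _ hm i j x)
  (fun i j x => is_derive_partial2 w _ hy i j x)
  (fun i j x => partial_comm w _ ow hm i j x)
  (fun i j x => partial_comm w _ ow hy i j x).
- move=> i j x wx; have := gram_eq x i j (cl x wx).
  by rewrite (mE x i wx) (mE x j wx) (yE x i wx) (yE x j wx).
- move=> x wx; have := cross_eq x (cl x wx).
  by rewrite (mE x _ wx) (mE x ord_max wx) (yE x _ wx) (yE x ord_max wx).
- by move=> x wx; have [+ _] := reg x (cl x wx); rewrite (yE x _ wx).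
- move=> x n wx; have [_] := reg x (cl x wx).
  by rewrite (yE x _ wx) (yE x ord_max wx).
exists c => x a b cx; have [E0 N0] := reg x cx.
apply: (frame_defect _ _ _ _ _ c a b (gram_eq x ord0 ord0 cx)
  (gram_eq x ord0 ord_max cx) (gram_eq x ord_max ord_max cx) (cross_eq x cx)
  E0 N0).
have FF : ProperFilter (within w (nbhs x)) by exact: within_nbhs_proper.
have Ly := partial_cvg w _ hy ord0 x cx; have Lm := partial_cvg w _ hm ord0 x cx.
have L1 := cvg_dot _ _ _ _ _ _ _ Lm Ly; have L2 := cvg_dot _ _ _ _ _ _ _ Ly Ly.
have L3 : (fun z => c * dot (partial ord0 y z) (partial ord0 y z)) z
    @[z --> within w (nbhs x)] --> c * dot (cpartial w ord0 y x) (cpartial w ord0 y x).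
  by apply: cvgM; [exact: cvg_cst|exact: (L2 _)].
apply: (cvg_unique (@Rhausdorff R) (L1 _)).
apply: cvg_trans L3; apply: (@near_eq_cvg _ _ (within w (nbhs x))).
by apply: filterS (withinT w _) => z wz; rewrite Pc.
Qed.

(** * The gradient of a function vanishing on a Lipschitz boundary *)

Section segments.
Context {R : realType} {V : normedModType R}.
Implicit Types (w : set V) (g dg : V -> R) (x v : V).

Lemma closure_segment w x v (a b s : R) : a < b ->
  (forall t, a < t < b -> w (x + t *: v)) -> a <= s <= b ->
  closure w (x + s *: v).
Proof.
move=> ab wab /andP[as_ sb] B nB.
have [r r0 rB] := nbhs_parallelogram _ v v _ nB.
(* [s] is moved towards the midpoint of the interval by the fraction [l]: it lands strictly inside
   because [0 < l < 1], and moves by less than [r] because [l * (b - a) < r]. *)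
pose l := r / (r + (b - a)); have rab : 0 < r + (b - a) by lra.
have l0 : 0 < l by exact: divr_gt0.
have lr : l * (r + (b - a)) = r by rewrite divfK // gt_eqF.
have l1 : l < 1 by rewrite ltr_pdivrMr //; lra.
pose t := s + l * ((a + b) / 2 - s); exists (x + t *: v); split.
  by apply: wab; apply/andP; split; rewrite /t; nra.
have -> : x + t *: v = x + s *: v + (l * ((a + b) / 2 - s)) *: v + 0 *: v.
  by rewrite scale0r addr0 -addrA -scalerDl.
apply: rB; last by rewrite normr0.
rewrite ltr_norml; apply/andP; split; nra.
Qed.

(** The endpoints may be boundary points, where only continuity of [g] on the closure is
    available. *)
Lemma MVT_open_segment w g dg x v (a b : R) : a < b ->
  (forall t, a < t < b -> w (x + t *: v)) ->
  {within closure w, continuous g} ->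
  (forall z, w z -> is_derive z v g (dg z)) ->
  exists2 t, a < t < b & g (x + b *: v) - g (x + a *: v) =
                         dg (x + t *: v) * (b - a).
Proof.
move=> ab wab /subspace_continuousP cg dgP.
have [||t tab E] := @MVT R (fun t => g (x + t *: v))
    (fun t => dg (x + t *: v)) a b ab.
- by move=> t; rewrite in_itv /= => tab; apply/is_derive_line/dgP/wab.
- apply/subspace_continuousP => s /=; rewrite in_itv /= => sab.
  have cs := closure_segment _ _ _ _ _ _ ab wab sab.
  apply: (@cvg_comp _ _ _ (fun t : R => x + t *: v) g _
    (within (closure w) (nbhs (x + s *: v)))); last exact: cg.
  move=> A nA; have line : (fun t : R => x + t *: v) @ s --> x + s *: v.
    by apply: cvgD; [exact: cvg_cst|apply: cvgZ; [exact: cvg_id|exact: cvg_cst]].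
  apply: (@filterS _ (nbhs s) _ _ _ _ (line _ nA)) => t At /=; rewrite in_itv /= => tab.
  exact: (At (closure_segment _ _ _ _ _ _ ab wab tab)).
by exists t => //; move: tab; rewrite in_itv.
Qed.

End segments.

(** [c2] is a sideways slope near 1; [c1] and [c3] are vertical slopes near 0. The vertical legs
    have lengths [L * a] and at most [2 * L * a], so the sum is at least
    [a * (1 - e * (1 + 3 * L))], which is [a / 2]. *)
Lemma sideways_dominates (R : realType) (a b e L c1 c2 c3 : R) :
  0 < a -> 1 <= L -> - (L * a) <= b -> b < L * a ->
  e * (1 + 3 * L) = 1 / 2 ->
  `|0 - c1| < e -> `|1 - c2| < e -> `|0 - c3| < e ->
  c1 * (L * a) + c2 * a - c3 * (L * a - b) <> 0.
Proof.
rewrite !ltr_norml => a0 L1 bl bh eL /andP[? ?] /andP[? ?] /andP[? ?] F.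
have h0 : 0 < L * a by apply: mulr_gt0 => //; lra.
have G1 : - e * (L * a) <= c1 * (L * a) by rewrite ler_pM2r //; lra.
have G2 : (1 - e) * a <= c2 * a by rewrite ler_pM2r //; lra.
have G3 : c3 * (L * a - b) <= e * (L * a - b) by rewrite ler_pM2r //; lra.
have e0 : 0 <= e by lra.
have G4 : e * (L * a - b) <= e * (2 * (L * a)) by apply: ler_wpM2l => //; lra.
have : a * (1 - e * (1 + 3 * L)) <= 0 by lra.
by rewrite eL; lra.
Qed.

Section lipschitz_boundary_gradient.
Context {R : realType} (w : set 'cV[R]_2) (p : 'cV[R]_2) (g : 'cV[R]_2 -> R)
  (dg : 'I_2 -> 'cV[R]_2 -> R) (l : 'I_2 -> R).
Hypotheses (ow : open w) (bp : boundary w p).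
Hypothesis cg : {within closure w, continuous g}.
Hypothesis dgP : forall i z, w z -> is_derive z (delta_mx i ord0) g (dg i z).
Hypothesis cdg : forall i z, w z -> {for z, continuous (dg i)}.
Hypothesis dgl : forall i, dg i z @[z --> within w (nbhs p)] --> l i.
Hypothesis g0 : \forall z \near p, boundary w z -> g z = 0.

(** The [k]-th row of [Q] as a plane vector: for orthogonal [Q], moving along it changes only the
    [k]-th local coordinate. *)
Let frame (Q : 'M[R]_2) k : 'cV[R]_2 :=
  Q k ord0 *: delta_mx ord0 ord0 + Q k ord_max *: delta_mx ord_max ord0.

Let slope (Q : 'M[R]_2) k z := Q k ord0 * dg ord0 z + Q k ord_max * dg ord_max z.

Let is_derive_slope Q k z : w z -> is_derive z (frame Q k) g (slope Q k z).
Proof.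
move=> wz; have nw : \forall z' \near z, w z' by exact: open_nbhs_nbhs.
apply: is_derive_lincomb.
- by apply: filterS nw => z'; exact: dgP.
- by apply: filterS nw => z'; exact: dgP.
- exact: cdg.
- exact: cdg.
Qed.

Let frame_coord (Q : 'M[R]_2) k (x : 'cV[R]_2) (a b : R) : Q^T *m Q = 1%:M ->
  (Q *m (x + a *: frame Q ord0 + b *: frame Q ord_max)) k ord0 =
  (Q *m x) k ord0 + (if k == ord0 then a else b).
Proof.
move=> /mulmx1C QQ.
have frameE k' : (Q *m frame Q k') k ord0 = (k == k')%:R.
  have -> : (k == k')%:R = (Q *m Q^T) k k' by rewrite QQ mxE.
  rewrite [LHS]mxE [RHS]mxE; apply: eq_bigr => j _; rewrite !mxE /=.
  by case: (ord2P j) => -> /=; ring.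
have mxD (A B : 'cV[R]_2) : (A + B) k ord0 = A k ord0 + B k ord0.
  by rewrite mxE.
have mxZ (s : R) (A : 'cV[R]_2) : (s *: A) k ord0 = s * A k ord0.
  by rewrite mxE.
rewrite !mulmxDr -!scalemxAr !mxD !mxZ !frameE -addrA.
by case: (ord2P k) => -> /=; rewrite ?mulr0 ?mulr1 ?addr0 ?add0r.
Qed.

Let near_coord (Q : 'M[R]_2) k (e : R) : 0 < e ->
  \forall z \near p, `|(Q *m p) k ord0 - (Q *m z) k ord0| < e.
Proof.
move=> e0; have QE z : (Q *m z) k ord0 =
    Q k ord0 * z ord0 ord0 + Q k ord_max * z ord_max ord0.
  rewrite mxE big_ord_recl big_ord1.
  by have -> : lift ord0 ord0 = ord_max :> 'I_2 by exact: val_inj.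
have coord i : (fun z : 'cV[R]_2 => z i ord0) @ p --> p i ord0.
  exact: coord_continuous.
have cQ : (fun z => Q k ord0 * z ord0 ord0 + Q k ord_max * z ord_max ord0) @ p
    --> Q k ord0 * p ord0 ord0 + Q k ord_max * p ord_max ord0.
  by apply: cvgD; apply: cvgM; [exact: cvg_cst|exact: coord
                               |exact: cvg_cst|exact: coord].
move/cvgrPdist_lt: cQ => /(_ e e0) nQ.
by apply: (@filterS _ (nbhs p) _ _ _ _ nQ) => z; rewrite -!QE.
Qed.

(** As [w] is open, [p] is outside [w] and so not above the graph; as a limit of points above the
    Lipschitz graph, it is not below either. *)
Let on_graph (Q : 'M[R]_2) (phi : R -> R) (M : R) : 0 <= M ->
  (forall s t, `|phi s - phi t| <= M * `|s - t|) ->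
  (\forall x \near p,
     w x <-> phi ((Q *m x) ord0 ord0) < (Q *m x) ord_max ord0) ->
  (Q *m p) ord_max ord0 = phi ((Q *m p) ord0 ord0).
Proof.
move=> M0 lip graph; have [cp np] := bp.
have {}np : ~ w p by move=> wp; apply: np; exact: open_nbhs_nbhs.
apply/eqP; rewrite eq_le; apply/andP; split.
  by rewrite leNgt; apply/negP => /(nbhs_singleton graph).
rewrite -subr_le0; apply/ler_addgt0Pr => e e0; rewrite add0r.
(* [M] times the horizontal error plus the vertical error then stays within [e]. *)
have d0 : 0 < e / (M + 1) by apply: divr_gt0 => //; lra.
have [z [wz [gz [z0 z1]]]] := cp _ (filterI graph
  (filterI (near_coord Q ord0 _ d0) (near_coord Q ord_max _ d0))).
have {}gz := gz.1 wz.
have lz := lip ((Q *m p) ord0 ord0) ((Q *m z) ord0 ord0).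
set d := e / (M + 1) in d0 z0 z1; have de : d * (M + 1) = e.
  by rewrite divfK // gt_eqF //; lra.
have lz' := le_trans lz (ler_wpM2l M0 (ltW z0)).
move: lz' z1; rewrite ler_norml ltr_norml => /andP[_ ?] /andP[? _]; lra.
Qed.

(* Going from [p] to a nearby boundary point up, sideways and down along the
   local graph, [g] changes only by the sideways part, to first order. *)
Lemma lipschitz_boundary_gradient (Q : 'M[R]_2) (phi : R -> R) :
  Q^T *m Q = 1%:M -> [lipschitz phi t | t in setT] ->
  (\forall x \near p,
     w x <-> phi ((Q *m x) ord0 ord0) < (Q *m x) ord_max ord0) ->
  Q ord0 ord0 * l ord0 + Q ord0 ord_max * l ord_max = 1 ->
  Q ord_max ord0 * l ord0 + Q ord_max ord_max * l ord_max = 0 -> False.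
Proof.
move=> QQ lipphi graph lu lv.
have [M M0 lip] : exists2 M : R, 0 <= M &
    forall s t, `|phi s - phi t| <= M * `|s - t|.
  have [M [_ MP]] := lipphi.
  (* The Lipschitz bound holds for every constant beyond the threshold [M]; this one is moreover
     nonnegative. *)
  exists (`|M| + 1) => [|s t]; first by rewrite addr_ge0.
  by apply: (MP (`|M| + 1) _ (s, t)) => //; have := ler_norm M; lra.
have pgraph := on_graph _ _ _ M0 lip graph.
set t0 := (Q *m p) ord0 ord0 in pgraph.
(* [L] exceeds the Lipschitz constant, so over a width [a] the graph stays strictly below height
   [L * a]; [e] is the slope tolerance of [sideways_dominates]. *)
pose L := M + 1; pose e := (2 * (1 + 3 * L))^-1.
have e0 : 0 < e by rewrite invr_gt0 /L; lra.
have eL : e * (1 + 3 * L) = 1 / 2 by rewrite /e; field; rewrite gt_eqF // /L; lra.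
pose u := frame Q ord0; pose v := frame Q ord_max.
have slope_lim k : slope Q k z @[z --> within w (nbhs p)] -->
    Q k ord0 * l ord0 + Q k ord_max * l ord_max.
  by apply: cvgD; apply: cvgM; [exact: cvg_cst|exact: dgl
                               |exact: cvg_cst|exact: dgl].
have nearu : \forall z \near p, w z -> `|1 - slope Q ord0 z| < e.
  by have := slope_lim ord0; rewrite lu => /cvgrPdist_lt/(_ e e0).
have nearv : \forall z \near p, w z -> `|0 - slope Q ord_max z| < e.
  by have := slope_lim ord_max; rewrite lv => /cvgrPdist_lt/(_ e e0).
have [r r0 rP] := nbhs_parallelogram p u v _
  (filterI (filterI graph g0) (filterI nearu nearv)).
pose pt a b := p + a *: u + b *: v.
have wpt a b : `|a| < r -> `|b| < r -> w (pt a b) <-> phi (t0 + a) - phi t0 < b.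
  move=> ar br; have [[+ _] _] := rP a b ar br.
  rewrite -/(pt a b) !frame_coord //= pgraph => ->.
  by rewrite ltrBlDl.
(* This makes both the width [a] and the height [h] smaller than [r]. *)
pose a := r / (2 * (L + 1)); pose h := L * a.
have L1 : 1 <= L by rewrite /L lerDr.
have L0 : 0 < 2 * (L + 1) by lra.
have ar2 : a * (2 * (L + 1)) = r by rewrite divfK // gt_eqF.
have a0 : 0 < a by exact: divr_gt0.
have h0 : 0 < h by rewrite /h mulr_gt0 //; lra.
have hr : h < r by rewrite /h; nra.
have ar : a < r by nra.
have small s b : 0 <= s <= a -> - h <= b <= h -> `|s| < r /\ `|b| < r.
  move=> /andP[s0 sa] bh; rewrite ger0_norm //; split; first exact: le_lt_trans ar.
  by apply: le_lt_trans hr; rewrite ler_norml.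
have phib s : 0 <= s <= a -> - h < phi (t0 + s) - phi t0 < h.
  move=> /andP[s0 sa]; have := lip (t0 + s) t0.
  rewrite [t0 + s]addrC addrK (ger0_norm s0) ler_norml => /andP[lo hi].
  have Msh : M * s < h by rewrite /h /L; nra.
  by rewrite (le_lt_trans _ Msh) // andbT (lt_le_trans _ lo) // ltrN2.
pose b := phi (t0 + a) - phi t0.
have aa : 0 <= a <= a by rewrite lexx ltW.
have /andP[hb bh] := phib a aa; rewrite -/b in hb bh.
have a00 : (0 : R) <= 0 <= a by rewrite lexx ltW.
have smallp s t : 0 <= s <= a -> 0 < t <= h -> `|s| < r /\ `|t| < r.
  move=> sa /andP[t1 t2]; apply: small sa _.
  by rewrite t2 andbT (le_trans _ (ltW t1)) // oppr_le0 ltW.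
have smallb t : b < t < h -> `|a| < r /\ `|t| < r.
  move=> /andP[t1 t2]; apply: small aa _.
  by rewrite (ltW (lt_trans hb t1)) (ltW t2).
have itvW (x y t : R) : x < t < y -> x < t <= y.
  by move=> /andP[-> /ltW].
have w1 t : 0 < t < h -> w (p + t *: v).
  move=> th; have [r1 r2] := smallp 0 t a00 (itvW _ _ _ th).
  have -> : p + t *: v = pt 0 t by rewrite /pt scale0r addr0.
  by apply/(wpt _ _ r1 r2); rewrite addr0 subrr; case/andP: th.
have hh : 0 < h <= h by rewrite h0 lexx.
have w2 t : 0 < t < a -> w (p + h *: v + t *: u).
  move=> /andP[/ltW t1 /ltW t2]; have ta : 0 <= t <= a by rewrite t1.
  have [r1 r2] := smallp t h ta hh.
  have -> : p + h *: v + t *: u = pt t h by rewrite /pt addrAC.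
  by apply/(wpt _ _ r1 r2); have /andP[] := phib t ta.
have w3 t : b < t < h -> w (p + a *: u + t *: v).
  move=> th; have [r1 r2] := smallb t th.
  by apply/(wpt _ _ r1 r2); case/andP: th.
(* The three legs: up from [p] to height [h], sideways by [a], and the vertical between heights [b]
   and [h] over the endpoint. *)
have [s1 t1 E1] := MVT_open_segment w g _ p v 0 h h0 w1 cg
  (is_derive_slope Q ord_max).
have [s2 t2 E2] := MVT_open_segment w g _ (p + h *: v) u 0 a a0 w2 cg
  (is_derive_slope Q ord0).
have [s3 t3 E3] := MVT_open_segment w g _ (p + a *: u) v b h bh w3 cg
  (is_derive_slope Q ord_max).
have gp : g p = 0 by exact: nbhs_singleton g0 bp.
(* The endpoint is in the closure as the end of the third leg, and outside [w] because it lies on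
   the graph. *)
have gq : g (p + a *: u + b *: v) = 0.
  have [|r1 r2] := small a b aa; first by apply/andP; split; exact: ltW.
  have [[_ g0q] _] := rP a b r1 r2; apply: g0q; split.
    by apply: (closure_segment _ _ _ _ _ _ bh w3); rewrite lexx ltW.
  move=> /interior_subset; rewrite -/(pt a b).
  by move/(wpt _ _ r1 r2); rewrite ltxx.
have n1 : `|0 - slope Q ord_max (p + s1 *: v)| < e.
  have [r1 r2] := smallp 0 s1 a00 (itvW _ _ _ t1).
  have [_ [_ n]] := rP 0 s1 r1 r2; rewrite scale0r addr0 in n.
  exact: n (w1 _ t1).
have n2 : `|1 - slope Q ord0 (p + h *: v + s2 *: u)| < e.
  have /andP[/ltW s2a /ltW s2b] := t2.
  have [|r1 r2] := smallp s2 h _ hh; first by rewrite s2a.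
  have [_ [n _]] := rP s2 h r1 r2; rewrite addrAC in n.
  exact: n (w2 _ t2).
have n3 : `|0 - slope Q ord_max (p + a *: u + s3 *: v)| < e.
  have [r1 r2] := smallb s3 t3.
  have [_ [_ n]] := rP a s3 r1 r2; exact: n (w3 _ t3).
rewrite gq scale0r !addr0 [p + h *: v + a *: u]addrAC gp in E1 E2 E3.
rewrite scale0r addr0 in E2; rewrite !subr0 in E1 E2 E3.
move: n1 n2 n3 E1 E2 E3.
set c1 := slope _ _ _; set c2 := slope _ _ _; set c3 := slope _ _ _.
move=> n1 n2 n3 E1 E2 E3; apply: (sideways_dominates _ a b e L _ _ _ _ _ _ _ _
  n1 n2 n3) => //.
- exact: ltW.
(* The three increments telescope between two zeros of [g]. *)
- by rewrite -/h -E1 -E2 -E3 [_ + (_ - _)]addrC subrK subrr.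
Qed.

End lipschitz_boundary_gradient.

(** * Equal gradients, linearly independent gradient differences, and the conclusion *)

Lemma isometric_gradients_eq (R : realType) (w : set 'cV[R]_2)
    (m y : 'cV[R]_2 -> 'cV[R]_3) p :
  open w -> connected w -> Ck_closure 2 w m -> Ck_closure 2 w y ->
  (forall x i, w x -> partial i m x = partial i y x) ->
  closure w p -> m p = y p -> forall x, closure w x -> m x = y x.
Proof.
move=> ow cw hm hy dE cp mp.
have [x0 [wx0 _]] : w `&` setT !=set0 by apply: cp; exact: filterT.
(* Each coordinate of [m - y] has zero partial derivatives, so the difference keeps its value at
   [x0]. *)
have cst x : w x -> m x = y x + (m x0 - y x0).
  move=> wx; apply/colP => k; have D z i (wz : w z) :
      is_derive z (delta_mx i ord0) (fun z' => m z' k ord0 - y z' k ord0) 0.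
    have dm := is_derive_coord _ _ _ _ _ _ _ k (is_derive_partial w _ hm i z wz).
    have dy := is_derive_coord _ _ _ _ _ _ _ k (is_derive_partial w _ hy i z wz).
    by apply: (is_derive_eq (is_deriveB dm dy)); rewrite (dE z i wz) subrr.
  have := derive0_cst _ _ _ ow cw D x x0 wx wx0.
  by rewrite !mxE => <-; rewrite addrC subrK.
have [cm _ _] := hm; have [cy _ _] := hy.
have E : forall x, closure w x -> m x = y x + (m x0 - y x0).
  apply: closure_eq0 cm _ cst.
  by apply: within_continuousD cy _; exact: cst_continuous.
have d0 : m x0 - y x0 = 0.
  by apply: (addrI (y p)); rewrite -E // mp addr0.
by move=> x cx; rewrite E // d0 addr0.
Qed.

(** Independence would allow a functional [xi] for which the gradient of [dot xi (m - y)] at [p] is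
    the first row of [Q], contradicting [lipschitz_boundary_gradient]. *)
Lemma isometric_not_free (R : realType) (w : set 'cV[R]_2)
    (m y : 'cV[R]_2 -> 'cV[R]_3) p :
  open w -> lipschitz_boundary w -> Ck_closure 2 w m -> Ck_closure 2 w y ->
  boundary w p -> (\forall x \near p, boundary w x -> m x = y x) ->
  ~ forall a b : R,
    a *: (cpartial w ord0 m p - cpartial w ord0 y p)
      + b *: (cpartial w ord_max m p - cpartial w ord_max y p) = 0 ->
    a = 0 /\ b = 0.
Proof.
move=> ow lip hm hy bp my free; have [cp _] := bp.
have [Q [phi [QQ lipphi graph]]] := lip p bp.
have [xi xi0 xi1] := free_dot _ _ _ (Q ord0 ord0) (Q ord0 ord_max) free.
have FF : ProperFilter (within w (nbhs p)) by exact: within_nbhs_proper.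
have QQ1 := mulmx1C QQ.
(* The rows of [Q] are orthonormal, so the chosen gradient has slope 1 along the first local axis
   and 0 along the second. *)
have rowQ k : Q k ord0 * Q ord0 ord0 + Q k ord_max * Q ord0 ord_max
    = (k == ord0)%:R.
  have -> : (k == ord0)%:R = (Q *m Q^T) k ord0 by rewrite QQ1 mxE.
  rewrite [RHS]mxE big_ord_recl big_ord1 ![Q^T _ _]mxE.
  by have -> : lift ord0 ord0 = ord_max :> 'I_2 by exact: val_inj.
apply: (lipschitz_boundary_gradient w p (fun x => dot xi (m x - y x))
  (fun i x => dot xi (partial i m x - partial i y x))
  (fun i => Q ord0 i) ow bp _ _ _ _ _ Q phi QQ lipphi graph) => //.
- have [/subspace_continuousP cm _ _] := hm.
  have [/subspace_continuousP cy _ _] := hy.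
  apply/subspace_continuousP => x cx.
  by apply: cvg_dot; [exact: cvg_cst | apply: cvgB; [exact: cm | exact: cy]].
- move=> i z wz; have dm := is_derive_partial w _ hm i z wz.
  have D := is_derive_dot _ _ _ _ _ _ _ _ (is_derive_cst xi z (delta_mx i ord0))
    (is_deriveB dm (is_derive_partial w _ hy i z wz)).
  by apply: (is_derive_eq D); rewrite dotC dot0r add0r.
- move=> i z wz; apply: (@cvg_dot _ _ (nbhs z) _ (fun=> xi)
    (fun x => partial i m x - partial i y x)); [exact: cvg_cst|apply: cvgB].
    exact: (partial_continuous w _ ow hm i z wz).
  exact: (partial_continuous w _ ow hy i z wz).
- move=> i; have L := cvg_dot _ _ _ _ _ _ _ (cvg_cst xi)
    (cvgB (partial_cvg w _ hm i p cp) (partial_cvg w _ hy i p cp)).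
  have <- : dot xi (cpartial w i m p - cpartial w i y p) = Q ord0 i.
    by case: (ord2P i) => ->; [exact: xi0 | exact: xi1].
  exact: L.
- by apply: filterS my => z /[apply] ->; rewrite subrr dot0r.
Qed.

Theorem corollary1p2 (R : realType) (w gd : set 'cV[R]_2)
    (m y0 : 'cV[R]_2 -> 'cV[R]_3)
    (hw : bounded_lipschitz_domain w)
    (hgd : relatively_open_in_boundary w gd) (gd0 : gd !=set0)
    (hm : Ck_closure 2 w m) (hy0 : Ck_closure 2 w y0)
    (rm : regular_surface w m) (ry0 : regular_surface w y0)
    (metric_eq : forall x, closure w x ->
       (jacobi w m x)^T *m jacobi w m x = (jacobi w y0 x)^T *m jacobi w y0 x)
    (normal_eq : forall x, closure w x ->
       normal_field w m x = normal_field w y0 x)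
    (boundary_eq : forall x, gd x -> m x = y0 x) :
  forall x, closure w x -> m x = y0 x.

Proof.
have [ow cw _ lip] := hw; have [U oU gdE] := hgd; have [p gp] := gd0.
have [Up bp] : (U `&` boundary w) p by rewrite -gdE.
have [cp _] := bp.
have [c defect] := gradient_defect R w m y0 ow cw hm hy0 ry0 metric_eq normal_eq.
have [c1|c1] := eqVneq c 1; last first.
  exfalso; apply: (isometric_not_free R w m y0 p ow lip hm hy0 bp).
    have nU : nbhs p U by exact: open_nbhs_nbhs.
    by apply: filterS nU => x Ux bx; apply: boundary_eq; rewrite gdE.
  (* As [1 - c] is nonzero, a vanishing combination of gradient differences forces the same
     combination of the partials of [y0] to vanish; regularity of [y0] concludes. *)
  move=> a b ab0; have /= := defect p a b cp; rewrite ab0.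
  rewrite dot0r => /esym/eqP.
  rewrite mulf_eq0 mulf_eq0 pnatr_eq0 subr_eq0 [1 == c]eq_sym (negbTE c1) /= => /eqP v0.
  exact: (regular_cpartial_free R w y0 p a b (ry0 p cp) (dot0_eq0 _ v0)).
apply: (isometric_gradients_eq R w m y0 p) => //; last exact: boundary_eq.
move=> x i wx; have cx : closure w x by exact: subset_closure.
rewrite -(cpartial_in w _ ow hm i x wx) -(cpartial_in w _ ow hy0 i x wx).
(* For [c = 1] every combination of gradient differences vanishes; the coefficients [(1, 0)] and
   [(0, 1)] isolate each partial derivative. *)
have c0 : 2 * (1 - c) = 0 by rewrite c1 subrr mulr0.
have S1 (A B : 'cV[R]_3) : 1 *: A + 0 *: B = A.
  by rewrite scale1r scale0r addr0.
have S2 (A B : 'cV[R]_3) : 0 *: A + 1 *: B = B.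
  by rewrite scale1r scale0r add0r.
apply: subr0_eq; case: (ord2P i) => ->; apply: dot0_eq0.
  by have /= := defect x 1 0 cx; rewrite c0 mul0r S1.
by have /= := defect x 0 1 cx; rewrite c0 mul0r S2.
Qed.
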